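(* Let $d\ge 1$ and let $\psi\in\mathbb{R}[x]=\mathbb{R}[x_1,\dots,x_d]$ be a polynomial which has at least three non-constant polynomial factors, i.e. $\psi=\varphi_1\varphi_2\cdots\varphi_k$ with $k\ge 3$ and each $\varphi_j\in\mathbb{R}[x]$ non-constant, and suppose that two of the factors have a common zero, i.e. there exist $i\neq j$ and $x_0\in\mathbb{R}^d$ with $\varphi_i(x_0)=\varphi_j(x_0)=0$. Then the Fischer operator $F_\psi:\mathbb{R}[x]\to\mathbb{R}[x]$, $F_\psi(q)=\Delta(\psi q)$, is not surjective.
   Context: $\mathbb{R}[x]$ denotes the set of all polynomials in $d$ variables with real coefficients, and $\Delta=\frac{\partial^2}{\partial x_1^2}+\cdots+\frac{\partial^2}{\partial x_d^2}$ is the Laplacian. For $\psi\in\mathbb{R}[x]$ the Fischer operator is $F_\psi(q):=\Delta(\psi q)$ for $q\in\mathbb{R}[x]$. *)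

(* Defs.v *)
From HB Require Import structures.
From mathcomp Require Import all_boot all_order all_algebra.
From mathcomp Require Import reals.
From mathcomp Require Import mpoly.
Set Implicit Arguments. Unset Strict Implicit. Unset Printing Implicit Defensive.
Import Order.TTheory GRing.Theory Num.Theory.
Local Open Scope ring_scope.

Definition laplacian (R : ringType) (d : nat) (p : {mpoly R[d]}) : {mpoly R[d]} :=
  \sum_(i < d) mderiv i (mderiv i p).

Definition fischer (R : comRingType) (d : nat) (psi : {mpoly R[d]})
  (q : {mpoly R[d]}) : {mpoly R[d]} := laplacian (psi * q).

Definition nonconstant (R : ringType) (d : nat) (p : {mpoly R[d]}) : Prop :=
  ~ (exists c : R, p = c%:MP).

(* Main.v *)
(* Translate the common zero x0 of two factors f, g to the origin and let I_N be
   the ideal of polynomials of order >= N there.  Since f g has order >= 2 and the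
   Laplacian lowers the order by at most 2, F_{fg} induces an endomorphism of the
   finite-dimensional space R[x]/I_N.  If F_psi is onto, with psi = f g h, then
   solving Delta(psi q) = Delta(f g) yields w = 1 - h q with F_{fg} w = 0, and
   w <> 0 because h is not a unit.  Choosing N with w not in I_N, the induced
   endomorphism is not injective, hence not surjective; but its image contains
   that of F_psi = F_{fg} o h, a contradiction. *)
Require Import Defs.
From HB Require Import structures.
From mathcomp Require Import all_boot all_order all_algebra.
From mathcomp Require Import reals.
From mathcomp Require Import mpoly.
Import GRing.Theory Num.Theory.
Local Open Scope ring_scope.

(** Constants and variables generate the algebra, so identities between morphisms or derivations
    need only be checked on these generators. *)
Lemma mpoly_alg_ind (R : comNzRingType) (d : nat) (P : {mpoly R[d]} -> Prop) :
  (forall c, P c%:MP) -> (forall i, P 'X_i) ->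
  (forall p q, P p -> P q -> P (p + q)) ->
  (forall p q, P p -> P q -> P (p * q)) -> forall p, P p.
Proof.
move=> PC PX PD PM; elim/mpolyind => [|c m p _ _ IHp]; first by rewrite -mpolyC0.
apply: (PD) => //; rewrite -mul_mpolyC; apply: (PM) => //; rewrite mpolyXE_id.
apply: (big_ind P) => [||i _]; [by rewrite -mpolyC1 | exact: PM |].
by elim: (m i) => [|k IHk]; rewrite ?expr0 -?mpolyC1 // exprS; apply: PM.
Qed.

Section Translation.
Variables (R : comNzRingType) (d : nat).
Implicit Types (a : 'I_d -> R) (p q : {mpoly R[d]}).

Definition translate a p : {mpoly R[d]} := p \mPo [tuple 'X_i + (a i)%:MP | i < d].

HB.instance Definition _ a := GRing.RMorphism.copy (translate a)
  (comp_mpoly [tuple 'X_i + (a i)%:MP | i < d]).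

Lemma translateC a c : translate a c%:MP = c%:MP.
Proof. exact: comp_mpolyC. Qed.

Lemma translateX a i : translate a 'X_i = 'X_i + (a i)%:MP.
Proof. by rewrite /translate comp_mpolyXU -tnth_nth tnth_mktuple. Qed.

Lemma translateK a b : (forall i, a i + b i = 0) -> cancel (translate a) (translate b).
Proof.
move=> ab0; elim/mpoly_alg_ind => [c|i|p q IHp IHq|p q IHp IHq].
- by rewrite !translateC.
- by rewrite translateX rmorphD /= translateX translateC -addrA -mpolyCD addrC
    [b i + _]addrC ab0 mpolyC0 add0r.
- by rewrite !rmorphD /= IHp IHq.
- by rewrite !rmorphM /= IHp IHq.
Qed.

Lemma mderiv_translate a i p : mderiv i (translate a p) = translate a (mderiv i p).
Proof.
elim/mpoly_alg_ind: p => [c|j|p q IHp IHq|p q IHp IHq].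
- by rewrite translateC !mderivC rmorph0.
- rewrite translateX mderivD mderivC addr0 mderivX mnm1E.
  case: eqP => [->|_]; last by rewrite !scale0r rmorph0.
  (* Writing each minuend as [0 + U_(i)] lets [addmK] reduce the exponent [U_(i) - U_(i)] to 0. *)
  by rewrite !scale1r -{1 3}[U_(i)%MM]add0m !addmK mpolyX0; apply/esym/comp_mpoly1.
- by rewrite rmorphD !mderivD IHp IHq rmorphD.
- by rewrite rmorphM !mderivM /= IHp IHq rmorphD !rmorphM.
Qed.

Lemma laplacian_translate a p : laplacian (translate a p) = translate a (laplacian p).
Proof.
by rewrite /laplacian raddf_sum; apply: eq_bigr => i _; rewrite !mderiv_translate.
Qed.

Lemma mcoeff0_meval p : p@_0 = p.@[fun=> 0].
Proof.
elim/mpoly_alg_ind: p => [c|i|p q IHp IHq|p q IHp IHq].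
- by rewrite mevalC mcoeffC eqxx mulr1.
- by rewrite mevalXU mcoeffX mnm1_eq0.
- by rewrite mevalD mcoeffD IHp IHq.
- by rewrite mevalM rmorphM /= IHp IHq.
Qed.

Lemma mcoeff0_translate a p : (translate a p)@_0 = p.@[a].
Proof.
rewrite mcoeff0_meval comp_mpoly_meval; apply: meval_eq => i.
by rewrite tnth_mktuple mevalD mevalXU mevalC add0r.
Qed.

(** Translation is a ring automorphism commuting with the Laplacian, so it conjugates one Fischer
    operator into the other. *)
Lemma fischer_translate_surj a p :
  (forall r, exists q, fischer p q = r) ->
  forall r, exists q, fischer (translate a p) q = r.
Proof.
move=> surj r; have [q Eq] := surj (translate (fun i => - a i) r).
exists (translate a q); rewrite /fischer -rmorphM laplacian_translate.
by rewrite -[laplacian _]/(fischer p q) Eq translateK // => i; rewrite addNr.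
Qed.

End Translation.

Section Order.
Variables (R : comNzRingType) (d : nat).
Implicit Types p q : {mpoly R[d]}.

Definition order_ge n p := forall m : 'X_{1..d}, (mdeg m < n)%N -> p@_m = 0.

Lemma order_ge1 p : p@_0 = 0 -> order_ge 1 p.
Proof. by move=> p0 m; rewrite ltnS leqn0 mdeg_eq0 => /eqP->. Qed.

(** If a monomial of degree below [m + n] splits as [a + b], then [a] has degree below [m] or [b]
    has degree below [n]. *)
Lemma order_geM m n p q : order_ge m p -> order_ge n q -> order_ge (m + n) (p * q).
Proof.
move=> Op Oq k ltk; rewrite mcoeffM big1 // => -[/= a b] /eqP Ek.
have [lta|lea] := ltnP (mdeg a) m; first by rewrite Op ?mul0r.
rewrite Oq ?mulr0 // -(ltn_add2l m); apply: leq_ltn_trans ltk.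
have /eq_leq : (mdeg a + mdeg b)%N = mdeg k by rewrite -mdegD -Ek.
by apply: leq_trans; rewrite leq_add2r.
Qed.

Lemma order_ge_mderiv n i p : order_ge n.+1 p -> order_ge n (mderiv i p).
Proof.
by move=> Op m ltm; rewrite mcoeff_mderiv Op ?mul0rn // mdegD mdeg1 addn1.
Qed.

Lemma order_ge_laplacian n p : order_ge n.+2 p -> order_ge n (laplacian p).
Proof.
move=> Op m ltm; rewrite /laplacian raddf_sum big1 //= => i _.
by apply: order_ge_mderiv ltm; apply: order_ge_mderiv.
Qed.

End Order.

Lemma fischer_is_linear (R : comNzRingType) (d : nat) (p : {mpoly R[d]}) :
  linear (fischer p).
Proof.
move=> c q1 q2; rewrite /fischer mulrDr -scalerAr /laplacian scaler_sumr -big_split.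
by apply: eq_bigr => i _ /=; rewrite !(mderivD, mderivZ).
Qed.

HB.instance Definition _ (R : comNzRingType) (d : nat) (p : {mpoly R[d]}) :=
  GRing.isLinear.Build R {mpoly R[d]} {mpoly R[d]} _ (fischer p) (fischer_is_linear R d p).

Section FiniteQuotient.
Variables (K : fieldType) (V : lmodType K) (n : nat).
Variables (T : {linear V -> 'rV[K]_n}) (S : {linear 'rV[K]_n -> V}) (F : {linear V -> V}).
Hypothesis SK : cancel S T.
Hypothesis FT : forall v, T v = 0 -> T (F v) = 0.

(** [T] identifies the quotient of [V] by its kernel with a finite-dimensional space, on which [F]
    induces the square matrix [A]; there, onto implies invertible. *)
Lemma quotient_surj_inj :
  (forall r, exists v, F v = r) -> forall w, F w = 0 -> T w = 0.
Proof.
move=> surj w Fw0; pose A := lin1_mx (T \o F \o S).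
(* The difference [v - S (T v)] lies in the kernel of [T], which [F] preserves. *)
have TF v : T (F v) = T v *m A.
  rewrite mul_rV_lin1 /=; apply/eqP; rewrite -subr_eq0 -!raddfB; apply/eqP/FT.
  by rewrite linearB /= SK subrr.
have Aunit : A \in unitmx.
  (* Each standard basis vector is [T (F v)] for some [v], hence lies in the row space of [A]. *)
  rewrite -row_full_unit -sub1mx; apply/row_subP => i.
  have [v Fv] := surj (S (row i 1%:M)).
  by rewrite -[row i _]SK -Fv TF submxMl.
by rewrite -[T w](mulmxK Aunit) -TF Fw0 raddf0 mul0mx.
Qed.

End FiniteQuotient.

Section Truncation.
Variables (K : fieldType) (d N : nat).
Local Notation mon := 'X_{1..d < N}.

(** Coordinates modulo the ideal of polynomials of order at least [N], in the basis of monomials of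
    degree below [N]. *)
Definition truncate (p : {mpoly K[d]}) : 'rV[K]_#|{: mon}| :=
  \row_i p@_(enum_val i : mon).

Definition untruncate (v : 'rV[K]_#|{: mon}|) : {mpoly K[d]} :=
  \sum_i v 0 i *: 'X_[(enum_val i : mon)].

Lemma truncate_is_linear : linear truncate.
Proof. by move=> c p q; apply/rowP => i; rewrite !mxE mcoeffD mcoeffZ. Qed.

Lemma untruncate_is_linear : linear untruncate.
Proof.
move=> c u v; rewrite /untruncate scaler_sumr -big_split; apply: eq_bigr => i _ /=.
by rewrite !mxE scalerDl scalerA.
Qed.

HB.instance Definition _ := GRing.isLinear.Build K _ _ _ truncate truncate_is_linear.
HB.instance Definition _ := GRing.isLinear.Build K _ _ _ untruncate untruncate_is_linear.

Lemma untruncateK : cancel untruncate truncate.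
Proof.
move=> v; apply/rowP => i; rewrite mxE raddf_sum (bigD1 i) //= big1 => [|j ji].
  by rewrite mcoeffZ mcoeffX eqxx mulr1 addr0.
by rewrite mcoeffZ mcoeffX -bmeqP (inj_eq enum_val_inj) (negPf ji) mulr0.
Qed.

Lemma truncate_eq0 p : truncate p = 0 <-> order_ge K d N p.
Proof.
split=> [/rowP p0 m ltm | Op]; last by apply/rowP=> i; rewrite !mxE Op ?bmdeg.
by have := p0 (enum_rank (BMultinom ltm)); rewrite !mxE enum_rankK.
Qed.

End Truncation.

Lemma fischer_surj_inj (K : fieldType) (d : nat) (p : {mpoly K[d]}) :
  order_ge K d 2 p -> (forall r, exists q, fischer p q = r) ->
  forall w, fischer p w = 0 -> w = 0.
Proof.
move=> Op surj w Fw0; apply/mpolyP => m; rewrite mcoeff0.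
(* The level [(mdeg m).+1] is the first whose truncation retains the coefficient of [m]. *)
have /truncate_eq0 -> // : truncate K d (mdeg m).+1 w = 0.
apply: (quotient_surj_inj _ _ _ _ _ (fischer p)) surj w Fw0.
  exact: untruncateK.
move=> v /truncate_eq0 Ov; apply/truncate_eq0/order_ge_laplacian.
by rewrite -add2n; apply: order_geM.
Qed.

Lemma fischer_not_surj (K : fieldType) (d : nat) (f g h : {mpoly K[d]}) (x0 : 'I_d -> K) :
  f.@[x0] = 0 -> g.@[x0] = 0 -> h \isn't a GRing.unit ->
  ~ (forall r, exists q, fischer (f * g * h) q = r).
Proof.
move=> f0 g0 hNunit /(fischer_translate_surj _ _ x0).
rewrite !rmorphM /=; set t := translate K d x0 => tsurj.
have Ofg : order_ge K d 2 (t f * t g).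
  by apply: (order_geM _ _ 1 1); apply: order_ge1; rewrite mcoeff0_translate.
have fgsurj r : exists q, fischer (t f * t g) q = r.
  (* The factor [t h] is absorbed into the argument. *)
  by have [q Eq] := tsurj r; exists (t h * q); rewrite -Eq /fischer mulrA.
have [q Eq] := tsurj (fischer (t f * t g) 1).
have /eqP : 1 - t h * q = 0.
  apply: fischer_surj_inj Ofg fgsurj _ _.
  by rewrite raddfB /= -Eq /fischer mulrA subrr.
(* Translating [t h * q = 1] back exhibits an inverse of [h]. *)
rewrite subr_eq0 eq_sym => /eqP /(congr1 (translate K d (fun i => - x0 i))).
rewrite rmorphM rmorph1 /= translateK => [hq1|i]; last by rewrite addrN.
by case/negP: hNunit; apply/unitrPr; exists (translate K d (fun i => - x0 i) q).
Qed.

Lemma nonconstantNunit (K : fieldType) (d : nat) (p : {mpoly K[d]}) :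
  nonconstant p -> p \isn't a GRing.unit.
Proof. by move=> ncp; apply/negP => /andP[/eqP pE _]; apply: ncp; exists p@_0. Qed.

Theorem theorem2 (R : realType) (d : nat) (psi : {mpoly R[d]})
  (phi : seq {mpoly R[d]}) :
  (1 <= d)%N ->
  (3 <= size phi)%N ->
  (forall j, (j < size phi)%N -> nonconstant (nth 0 phi j)) ->
  psi = \prod_(f <- phi) f ->
  (exists (i j : nat) (x0 : 'I_d -> R),
      [/\ (i < size phi)%N, (j < size phi)%N, i <> j,
          (nth 0 phi i).@[x0] = 0 & (nth 0 phi j).@[x0] = 0]) ->
  ~ (forall r : {mpoly R[d]}, exists q : {mpoly R[d]}, fischer psi q = r).
Proof.
move=> _ sz3 ncphi psiE [i [j [x0 [lti ltj /eqP ij fi0 fj0]]]] surj.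
(* One of the indices 0, 1, 2 differs from both [i] and [j]. *)
have [l ltl /andP[li lj]] : exists2 l, (l < size phi)%N & (l != i) && (l != j).
  move: ij; have [lt0 lt1] := (ltnW (ltnW sz3), ltnW sz3).
  case: (i) (j) => [|[|?]] [|[|?]] //= _; solve [by exists 0 | by exists 1 | by exists 2].
have EP : psi = nth 0 phi i * nth 0 phi j * (nth 0 phi l *
    \prod_(k < size phi | [&& k != i :> nat, k != j :> nat & k != l :> nat]) nth 0 phi k).
  rewrite psiE (big_nth 0) big_mkord (bigD1 (Ordinal lti)) //= -!mulrA; congr (_ * _).
  rewrite (bigD1 (Ordinal ltj)) /=; last by rewrite -val_eqE /= eq_sym.
  congr (_ * _); rewrite (bigD1 (Ordinal ltl)) /=; last by rewrite -!val_eqE /= li lj.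
  by congr (_ * _); apply: eq_bigl => k; rewrite -!val_eqE /= andbA.
rewrite EP in surj; apply: (fischer_not_surj _ _ _ _ _ _ fi0 fj0) surj.
(* Here [h] collects all remaining factors; a product with the non-unit factor of index [l] is not a
   unit. *)
by rewrite unitrM negb_and nonconstantNunit //; apply: ncphi.
Qed.
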